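(* Let $L\colon\widehat{\mathcal M}'_T\to\mathbb C/4\pi^2\mathbb Z$, where $\widehat{\mathcal M}'_T=\{(u_1,u_2)\in\mathbb C^2:e^{u_1}+e^{u_2}=1\}$, be the function constructed from spin Chern-Simons theory as in the context (for any choice of nonzero flat section $\tau'$). For the diffeomorphism $$\Psi\colon\widehat{\mathcal M}'_T\to\widehat{\mathcal M}'_T,\qquad (u_1,u_2)\mapsto(u_2,u_1),$$ the sum $L+\Psi^*L$ is a constant function.
   Context: Write $i=\sqrt{-1}$. Torus. $T=\mathbb R^2/\mathbb Z^2$ with coordinates $\theta^1,\theta^2$, oriented by $d\theta^1\wedge d\theta^2$, with the spin structure for which both coordinate loops inherit the bounding spin structure. The associated quadratic refinement of the intersection pairing is $\sigma(n_1,n_2)=n_1n_2\bmod 2$ on $H^1(T;\mathbb Z/2)$, in the standard basis. Moduli spaces. $\widehat{\mathcal M}_T=\mathbb C^2$ with coordinates $u_1,u_2$; $\mathcal M_T=(\mathbb C^\times)^2$ with coordinates $\mu_1,\mu_2$; $e\colon\widehat{\mathcal M}_T\to\mathcal M_T$, $e(u_1,u_2)=(e^{u_1},e^{u_2})$, a principal $\mathbb Z^2$-bundle. $\widehat{\mathcal M}'_T=\{e^{u_1}+e^{u_2}=1\}\subset\widehat{\mathcal M}_T$, $\mathcal M'_T=\{\mu_1+\mu_2=1\}\subset\mathcal M_T$, and $e'\colon\widehat{\mathcal M}'_T\to\mathcal M'_T$ is the restriction of $e$. Universal connection. On the trivial principal $\mathbb C^\times$-bundle $\widehat{\mathcal M}_T\times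 T\times\mathbb C^\times\to\widehat{\mathcal M}_T\times T$ with section $\hat t_0(u,\theta)=(u,\theta,1)$, let $\hat\eta$ be the connection with $\hat t_0^*\hat\eta=-u_1d\theta^1-u_2d\theta^2$. The action $(n_1,n_2)\cdot(u_1,u_2,\theta^1,\theta^2,\lambda)=(u_1+2\pi in_1,u_2+2\pi in_2,\theta^1,\theta^2,e^{2\pi i(n_1\theta^1+n_2\theta^2)}\lambda)$ of $\mathbb Z^2$ preserves $\hat\eta$, so the bundle with connection descends to $\rho\colon\mathcal Q\to\mathcal M_T\times T$ with connection $\eta$, of curvature $\Omega(\eta)$. It is flat along each $\{\mu\}\times T$. Spin Chern-Simons line bundle. $\mathcal L\to\mathcal M_T$ is the line bundle whose fiber at $\mu$ is the space of functions $f$ on the set of smooth sections $t$ of $\mathcal Q|_{\{\mu\}\times T}\to T$ satisfying $$f(t\cdot h)=(-1)^{\sigma([h])}\exp\Bigl(-\frac{i}{4\pi}\int_Tt^*\eta\wedge\frac{dh}{h}\Bigr)f(t)$$ for all smooth $h\colon T\to\mathbb C^\times$, where $[h]\in H^1(T;\mathbb Z/2)$ is the mod 2 reduction of the homotopy class of $h$. A section $t$ of $\mathcal Q$ over $U\times T$, $U\subset\mathcal M_T$ open, gives a trivialization $\tau_t$ of $\mathcal L|_U$ (the function with value $1$ at $t$), and the covariant derivative on $\mathcal L$ is determined by $\nabla\tau_t=\bigl(\frac{i}{4\pi}\int_Tt^*\eta\wedge\Omega(\eta)\bigr)\tau_t$ (integration over the fiber $T$). In the same way $\hat t_0$ gives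 a trivialization $\hat\tau_0$ of $e^*\mathcal L\to\widehat{\mathcal M}_T$. Let $\mathcal L'=\mathcal L|_{\mathcal M'_T}$ and let $\hat\tau_0'$ be the restriction of $\hat\tau_0$ to $\widehat{\mathcal M}'_T$. The function $L$. The bundle $\mathcal L'\to\mathcal M_T'$ is flat with trivial holonomy, so it has nonzero flat sections $\tau'$, unique up to a constant in $\mathbb C^\times$. For a choice of $\tau'$ set $\varphi=\hat\tau_0'/(e')^*\tau'\colon\widehat{\mathcal M}'_T\to\mathbb C^\times$ and define $L\colon\widehat{\mathcal M}'_T\to\mathbb C/4\pi^2\mathbb Z$ by $\varphi=\exp(L/2\pi i)$. Changing $\tau'$ changes $L$ by an additive constant. *)

(* Defs.v *)
(* Stdlib real numbers and Coquelicot: [C] is [R * R]. *)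
From Stdlib Require Import Reals ZArith Bool IndefiniteDescription Lra.
From Coquelicot Require Import Coquelicot.

Open Scope R_scope.

Definition Cexp (z : C) : C := (exp (Re z) * cos (Im z), exp (Re z) * sin (Im z)).

Lemma Cexp_neq_0 (z : C) : Cexp z <> 0%C.
Proof.
  unfold Cexp; intros [= H1 H2].
  pose proof (exp_pos (Re z)) as He.
  pose proof (sin2_cos2 (Im z)) as H; unfold Rsqr in H.
  apply Rmult_integral in H1; apply Rmult_integral in H2; nra.
Qed.

Definition Cx : Type := {z : C | z <> 0%C}.
Definition Cx_val (z : Cx) : C := proj1_sig z.
Coercion Cx_val : Cx >-> C.

Definition Cx_one : Cx := exist _ (RtoC 1) C1_nz.
Definition Cx_exp (z : C) : Cx := exist _ (Cexp z) (Cexp_neq_0 z).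
Definition Cx_mul (z w : Cx) : Cx :=
  exist _ (z * w)%C (Cmult_neq_0 z w (proj2_sig z) (proj2_sig w)).

(* The set of classes of [E]; it is only used for equivalence relations.
   [rep] chooses a representative. *)
Definition quot {A : Type} (E : A -> A -> Prop) : Type :=
  {S : A -> Prop | exists a, S = E a}.
Definition cl {A : Type} (E : A -> A -> Prop) (a : A) : quot E :=
  exist _ (E a) (ex_intro _ a eq_refl).
Definition rep {A : Type} {E : A -> A -> Prop} (q : quot E) : A :=
  proj1_sig (constructive_indefinite_description _ (proj2_sig q)).

(* Class C^k on [D], which is always an open subset of a finite-dimensional
   space: every directional derivative exists and is of class C^(k-1). *)
Fixpoint Ck {V W : NormedModule R_AbsRing} (k : nat) (D : V -> Prop) (f : V -> W)
    : Prop :=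
  (forall x, D x -> continuous f x) /\
  match k with
  | O => True
  | S k' => forall v : V, exists g : V -> W,
      (forall x, D x -> is_derive (fun s : R => f (plus x (scal s v))) 0 (g x)) /\
      Ck k' D g
  end.

Definition smooth_on {V W : NormedModule R_AbsRing} (D : V -> Prop) (f : V -> W)
    : Prop := forall k, Ck k D f.

Definition ddir {V : NormedModule R_AbsRing} (f : V -> C) (x v : V) : C :=
  (Derive (fun s : R => Re (f (plus x (scal s v)))) 0,
   Derive (fun s : R => Im (f (plus x (scal s v)))) 0).

Definition int_square (F : R * R -> C) : C :=
  (RInt (fun x => RInt (fun y => Re (F (x, y))) 0 1) 0 1,
   RInt (fun x => RInt (fun y => Im (F (x, y))) 0 1) 0 1).

Definition torus_rel (x y : R * R) : Prop :=
  exists m : Z * Z, y = (fst x + IZR (fst m), snd x + IZR (snd m)).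
Definition torus : Type := quot torus_rel.
Definition pT : R * R -> torus := cl torus_rel.

Definition smooth_torus (h : torus -> Cx) : Prop :=
  smooth_on (fun _ : R * R => True) (fun x : R * R => Cx_val (h (pT x))).

Definition character (n : Z * Z) (theta : torus) : Cx :=
  Cx_exp (2 * PI * Ci *
          (IZR (fst n) * fst (rep theta) + IZR (snd n) * snd (rep theta)))%C.

(* The homotopy class of [h : torus -> Cx] is [n], homotopy classes being
   identified with H^1(torus; Z) = Z^2 by means of the characters.  The homotopy
   is defined for all real times; only [0, 1] matters, since a homotopy on [0, 1]
   extends by constants. *)
Definition homotopy_class (h : torus -> Cx) (n : Z * Z) : Prop :=
  exists H : R -> torus -> Cx,
    (forall p : R * (R * R),
        continuous (fun q : R * (R * R) => Cx_val (H (fst q) (pT (snd q)))) p) /\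
    (forall theta, H 0 theta = h theta) /\
    (forall theta, H 1 theta = character n theta).

Definition mod2 (n : Z * Z) : bool * bool := (Z.odd (fst n), Z.odd (snd n)).
Definition sigma (a : bool * bool) : bool := fst a && snd a.
Definition sign (b : bool) : C := if b then (- (1))%C else 1%C.

Definition MT (mu : C * C) : Prop := fst mu <> 0%C /\ snd mu <> 0%C.
Definition MT' (mu : C * C) : Prop := MT mu /\ (fst mu + snd mu)%C = 1%C.

Definition e (u : C * C) : C * C := (Cexp (fst u), Cexp (snd u)).
Definition de (u v : C * C) : C * C :=
  ((Cexp (fst u) * fst v)%C, (Cexp (snd u) * snd v)%C).

Definition MThat' : Type := {u : C * C | (Cexp (fst u) + Cexp (snd u))%C = 1%C}.

Definition Psi (u : MThat') : MThat' :=
  exist (fun w : C * C => (Cexp (fst w) + Cexp (snd w))%C = 1%C)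
    (snd (proj1_sig u), fst (proj1_sig u))
    (eq_trans (Cplus_comm _ _) (proj2_sig u)).

Definition shift (n : Z * Z) (u : C * C) : C * C :=
  ((fst u + 2 * PI * Ci * IZR (fst n))%C, (snd u + 2 * PI * Ci * IZR (snd n))%C).

Definition Q_rel (p q : (C * C) * torus * Cx) : Prop :=
  exists n : Z * Z,
    q = (shift n (fst (fst p)), snd (fst p),
         Cx_mul (character n (snd (fst p))) (snd p)).
Definition Q : Type := quot Q_rel.

Definition Q_act (q : Q) (z : Cx) : Q :=
  cl Q_rel (fst (rep q), Cx_mul (snd (rep q)) z).

(* [g] is the section [t] of Q over {e u} x torus read in the trivialization
   lambda |-> cl (u, theta, lambda), i.e. t = that0 g at [u]. *)
Definition lifts (u : C * C) (g : torus -> Cx) (t : torus -> Q) : Prop :=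
  smooth_torus g /\ forall theta, t theta = cl Q_rel (u, theta, g theta).

Definition is_section (mu : C * C) (t : torus -> Q) : Prop :=
  exists u g, e u = mu /\ lifts u g t.

(* A smooth section [t] of Q over U x torus, together with its pullback
   that0 g to e^{-1}(U) x torus. *)
Definition section_over (U : C * C -> Prop) (t : C * C -> torus -> Q)
    (g : C * C -> torus -> Cx) : Prop :=
  smooth_on (fun p : (C * C) * (R * R) => U (e (fst p)))
    (fun p : (C * C) * (R * R) => Cx_val (g (fst p) (pT (snd p)))) /\
  forall u theta, U (e u) -> t (e u) theta = cl Q_rel (u, theta, g u theta).

Definition that0 (u : C * C) : torus -> Q := fun theta => cl Q_rel (u, theta, Cx_one).

(* Complex-valued forms on MThat x torus, in the linear coordinates of its
   cover [cover]; a form takes a point and constant tangent vectors. *)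

Definition cover : Type := ((C * C) * (R * R))%type.
Definition form1 : Type := cover -> cover -> C.
Definition form2 : Type := cover -> cover -> cover -> C.
Definition form3 : Type := cover -> cover -> cover -> cover -> C.

Definition ext_d (a : form1) : form2 := fun p X Y =>
  (ddir (fun q : cover => a q Y) p X
   - ddir (fun q : cover => a q X) p Y)%C.

Definition wedge11 (a b : form1) : form2 := fun p X Y =>
  (a p X * b p Y - a p Y * b p X)%C.

Definition wedge12 (a : form1) (b : form2) : form3 := fun p X Y Z =>
  (a p X * b p Y Z - a p Y * b p X Z + a p Z * b p X Y)%C.

Definition horizontal (v : C * C) : cover := (v, (0, 0)).
Definition d_theta1 : cover := ((RtoC 0, RtoC 0), (1, 0)).
Definition d_theta2 : cover := ((RtoC 0, RtoC 0), (0, 1)).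

Definition int_torus2 (w : form2) (u : C * C) : C :=
  int_square (fun x => w (u, x) d_theta1 d_theta2).
Definition int_torus3 (w : form3) (u v : C * C) : C :=
  int_square (fun x => w (u, x) (horizontal v) d_theta1 d_theta2).

Definition dlog (g : cover -> C) : form1 := fun p X =>
  (ddir (g : (C * C) * (R * R) -> C) p X / g p)%C.

(* The connection form on the total space MThat x torus x Cx, at the point
   ((u, x), lambda), applied to the tangent vector (X, l).  Being dlambda/lambda
   along the fibers and invariant, it is determined by its pullback by the
   section lambda = 1. *)
Definition eta_hat (p : cover * C) (X : cover * C) : C :=
  let u := fst (fst p) in
  let w := snd (fst X) in
  (snd X / snd p - fst u * fst w - snd u * snd w)%C.

(* Pullback of [eta_hat] by the section that0 g. *)
Definition pull_eta (g : cover -> C) : form1 := fun p X =>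
  eta_hat (p, g p) (X, ddir (g : (C * C) * (R * R) -> C) p X).

(* The curvature; the structure group is abelian, so it is the exterior
   derivative of the pullback of the connection by any section. *)
Definition Omega : form2 := ext_d (pull_eta (fun _ => RtoC 1)).

(* The lift at one point [u], as a function on the cover constant in [u]. *)
Definition on_cover (g : torus -> Cx) : cover -> C :=
  fun p => Cx_val (g (pT (snd p))).
Definition family_on_cover (g : C * C -> torus -> Cx) : cover -> C :=
  fun p => Cx_val (g (fst p) (pT (snd p))).

(* The functions on the set of smooth sections of Q over {mu} x torus are
   represented by the functions on [torus -> Q] that vanish off this set. *)
Definition CS_fiber (mu : C * C) (f : (torus -> Q) -> C) : Prop :=
  (forall t, ~ is_section mu t -> f t = RtoC 0) /\
  (forall (u : C * C) (g : torus -> Cx) (t : torus -> Q) (h : torus -> Cx)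
          (n : Z * Z),
     e u = mu -> lifts u g t -> smooth_torus h -> homotopy_class h n ->
     f (fun theta => Q_act (t theta) (h theta)) =
     (sign (sigma (mod2 n)) *
      Cexp (- (Ci / (4 * PI)) *
            int_torus2 (wedge11 (pull_eta (on_cover g)) (dlog (on_cover h))) u) *
      f t)%C).

Definition CS_section : Type := C * C -> (torus -> Q) -> C.

(* The connection form of the trivialization tau_t, t = that0 g, pulled back
   by e. *)
Definition CS_connection (g : C * C -> torus -> Cx) (u v : C * C) : C :=
  (Ci / (4 * PI) *
   int_torus3 (wedge12 (pull_eta (family_on_cover g)) Omega) u v)%C.

Definition coefficient (s : CS_section) (t : C * C -> torus -> Q) (mu : C * C) : C :=
  s mu (t mu).

(* The coefficient, in the trivialization tau_t with t = that0 g, of the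
   covariant derivative of [s] at e u along the tangent vector (de u v). *)
Definition nabla (s : CS_section) (t : C * C -> torus -> Q)
    (g : C * C -> torus -> Cx) (u v : C * C) : C :=
  (ddir (coefficient s t : C * C -> C) (e u) (de u v)
   + CS_connection g u v * coefficient s t (e u))%C.

Definition trivializing (U : C * C -> Prop) (t : C * C -> torus -> Q)
    (g : C * C -> torus -> Cx) : Prop :=
  open U /\ (forall mu, U mu -> MT mu) /\ section_over U t g.

(* Smoothness of the restriction of [s] to MT', in the coordinate
   z |-> (z, 1 - z) on MT'. *)
Definition smooth_section' (s : CS_section) : Prop :=
  (forall mu, MT' mu -> CS_fiber mu (s mu)) /\
  forall U t g, trivializing U t g ->
    smooth_on (fun z : R * R => U ((z : C), (1 - z)%C))
      (fun z : R * R => coefficient s t ((z : C), (1 - z)%C)).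

(* The tangent vectors of MT' are those with coordinates of sum zero. *)
Definition flat_section' (s : CS_section) : Prop :=
  smooth_section' s /\
  forall U t g, trivializing U t g ->
  forall u v : C * C,
    U (e u) -> MT' (e u) -> (fst (de u v) + snd (de u v))%C = RtoC 0 ->
    nabla s t g u v = RtoC 0.

Definition nonzero_section' (s : CS_section) : Prop :=
  exists mu, MT' mu /\ exists t, s mu t <> RtoC 0.

Definition is_tau0hat (tau0 : CS_section) : Prop :=
  forall u, CS_fiber (e u) (tau0 u) /\ tau0 u (that0 u) = RtoC 1.

Definition CmodZ_rel (a b : C) : Prop :=
  exists k : Z, b = (a + 4 * PI ^ 2 * IZR k)%C.
Definition CmodZ : Type := quot CmodZ_rel.
Definition CmodZ_add (a b : CmodZ) : CmodZ := cl CmodZ_rel (rep a + rep b)%C.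

(* exp (l / 2 pi i) does not depend on the representative of [l]. *)
Definition exp_2pii (l : CmodZ) : C := Cexp (rep l / (2 * PI * Ci))%C.

(* [L] is a function obtained from the flat section [tau'] and from tau0hat,
   through their ratio [phi]. *)
Definition is_CS_function (tau' tau0 : CS_section) (phi : MThat' -> Cx)
    (L : MThat' -> CmodZ) : Prop :=
  (forall (u : MThat') (t : torus -> Q),
     tau0 (proj1_sig u) t = (phi u * tau' (e (proj1_sig u)) t)%C) /\
  (forall u : MThat', Cx_val (phi u) = exp_2pii (L u)).

(* Main.v *)
From Stdlib Require Import Reals ZArith Bool Lra.
From Stdlib Require Import FunctionalExtensionality PropExtensionality.
From Stdlib Require Import ProofIrrelevance IndefiniteDescription.
From Coquelicot Require Import Coquelicot.
Require Import Defs.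

Open Scope R_scope.

(** Let [F u] be the value of [tau'] at the section [that0 u], so that [F] is the
    inverse of [phi]; the claim is that [F u * F (Psi u)] is constant.  Flatness
    gives [dF = - (i / 4 pi) (u_2 du_1 - u_1 du_2) F] on [MThat'], and the form
    changes sign under [Psi], so the product is locally constant.  Under a deck
    transformation [n] the function [F] is multiplied by a sign, symmetric in
    [n_1] and [n_2], and by the exponential of an expression antisymmetric under
    [Psi]; hence the product descends to [MT'], which is [C] minus two points, and
    only the connectedness of the latter is needed. *)

(** * The complex exponential and its periods *)

Lemma Cexp_add (z w : C) : Cexp (z + w)%C = (Cexp z * Cexp w)%C.
Proof.
  destruct z as [a b], w as [c d]; unfold Cexp, Cmult, Cplus; cbn.
  rewrite exp_plus, cos_plus, sin_plus; f_equal; ring.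
Qed.

Lemma Cexp_0 : Cexp 0%C = 1%C.
Proof.
  unfold Cexp; cbn; rewrite exp_0, cos_0, sin_0, !Rmult_1_l; reflexivity.
Qed.

Lemma cos_eq_1_period (d : R) : cos d = 1 -> exists k : Z, d = 2 * PI * IZR k.
Proof.
  intros H.
  replace d with (2 * (d / 2)) in H by lra.
  rewrite cos_2a_sin in H.
  assert (Hs : sin (d / 2) = 0) by nra.
  destruct (sin_eq_0_0 _ Hs) as [k Hk]; exists k; lra.
Qed.

Lemma cos_sin_period (x : R) (k : Z) :
  cos (x + 2 * PI * IZR k) = cos x /\ sin (x + 2 * PI * IZR k) = sin x.
Proof.
  assert (Hs : sin (PI * IZR k) = 0)
    by (apply sin_eq_0_1; exists k; ring).
  assert (Hc : cos (2 * PI * IZR k) = 1).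
  { replace (2 * PI * IZR k) with (2 * (PI * IZR k)) by ring.
    rewrite cos_2a_sin, Hs; ring. }
  assert (Hs2 : sin (2 * PI * IZR k) = 0).
  { replace (2 * PI * IZR k) with (2 * (PI * IZR k)) by ring.
    rewrite sin_2a, Hs; ring. }
  rewrite cos_plus, sin_plus, Hc, Hs2; lra.
Qed.

Lemma Cexp_period (z : C) (k : Z) : Cexp (z + 2 * PI * Ci * IZR k)%C = Cexp z.
Proof.
  destruct z as [a b]; unfold Cexp; cbn.
  replace (b + _) with (b + 2 * PI * IZR k) by ring.
  replace (a + _) with a by ring.
  destruct (cos_sin_period b k) as [-> ->]; reflexivity.
Qed.

Lemma Cexp_inj_period (z w : C) :
  Cexp z = Cexp w -> exists k : Z, z = (w + 2 * PI * Ci * IZR k)%C.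
Proof.
  destruct z as [a b], w as [c d]; unfold Cexp; cbn; intros [= Hc Hs].
  pose proof (sin2_cos2 b) as Hb; pose proof (sin2_cos2 d) as Hd.
  unfold Rsqr in Hb, Hd.
  pose proof (exp_pos a) as Ha; pose proof (exp_pos c) as Hc'.
  (* The squared moduli agree because [cos^2 + sin^2 = 1], and both moduli are positive. *)
  assert (Hexp : exp a = exp c).
  { assert (exp a * exp a = exp c * exp c) by
      (transitivity ((exp a * cos b) * (exp a * cos b)
                     + (exp a * sin b) * (exp a * sin b)); [nra|];
       rewrite Hc, Hs; nra).
    nra. }
  rewrite Hexp in Hc, Hs.
  apply Rmult_eq_reg_l in Hc; [|lra]; apply Rmult_eq_reg_l in Hs; [|lra].
  destruct (cos_eq_1_period (b - d)) as [k Hk].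
  { rewrite cos_minus, Hc, Hs; lra. }
  exists k; unfold Cplus, Cmult; cbn; f_equal.
  - apply exp_inv in Hexp; lra.
  - lra.
Qed.

(** * Branches of the logarithm on half-planes *)

(** The points whose argument is within [PI / 2] of [alpha], written as positivity of the real part
    after rotation by [- alpha]. *)
Definition half_plane (alpha : R) (mu : C) : Prop :=
  0 < Re mu * cos alpha + Im mu * sin alpha.

(** After rotation by [- alpha] the real part is positive, so the argument there is the arctangent
    of the slope; adding [alpha] undoes the rotation. *)
Definition log_branch (alpha : R) (mu : C) : C :=
  (ln (Cmod mu),
   alpha + atan ((Im mu * cos alpha - Re mu * sin alpha)
                 / (Re mu * cos alpha + Im mu * sin alpha))).

(** Adding [/ 2] turns the integer part into rounding. For [w] above the half-plane this is the [k]
    for which [w] is the branch value plus [2 PI i k]. *)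
Definition sheet (alpha : R) (w : C) : Z :=
  Int_part ((Im w - alpha) / (2 * PI) + / 2).

Lemma half_plane_neq_0 (alpha : R) (mu : C) : half_plane alpha mu -> mu <> 0%C.
Proof. unfold half_plane; intros H ->; cbn in H; lra. Qed.

Lemma Cexp_log_branch (alpha : R) (mu : C) :
  half_plane alpha mu -> Cexp (log_branch alpha mu) = mu.
Proof.
  intros H.
  assert (Hm : 0 < Cmod mu) by (apply Cmod_gt_0, (half_plane_neq_0 alpha), H).
  unfold half_plane in H; destruct mu as [a b]; cbn in H.
  unfold Cexp, log_branch; cbn [Re Im fst snd].
  rewrite (exp_ln _ Hm).
  set (X := a * cos alpha + b * sin alpha) in *.
  set (Y := b * cos alpha - a * sin alpha).
  pose proof (sin2_cos2 alpha) as Ha; unfold Rsqr in Ha.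
  (* [X] and [Y] are the coordinates in the rotated frame; the square root cancels the one in the
     cosine and sine of the arctangent. *)
  assert (Hmod : Cmod (a, b) = X * sqrt (1 + (Y / X)²)).
  { unfold Cmod; cbn [fst snd].
    rewrite <- (sqrt_Rsqr X) at 1 by lra.
    rewrite <- sqrt_mult_alt by apply Rle_0_sqr.
    f_equal; unfold Rsqr.
    transitivity (X * X + Y * Y); [|field; lra].
    unfold X, Y.
    transitivity ((a * a + b * b) * (sin alpha * sin alpha + cos alpha * cos alpha));
      [rewrite Ha|]; ring. }
  assert (Hs : 0 < sqrt (1 + (Y / X)²)).
  { apply sqrt_lt_R0; pose proof (Rle_0_sqr (Y / X)); lra. }
  rewrite cos_plus, sin_plus, cos_atan, sin_atan, Hmod.
  f_equal.
  - transitivity (X * cos alpha - Y * sin alpha); [field; lra|].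
    unfold X, Y.
    transitivity (a * (sin alpha * sin alpha + cos alpha * cos alpha));
      [|rewrite Ha]; ring.
  - transitivity (X * sin alpha + Y * cos alpha); [field; lra|].
    unfold X, Y.
    transitivity (b * (sin alpha * sin alpha + cos alpha * cos alpha));
      [|rewrite Ha]; ring.
Qed.

Lemma sheet_unique (alpha : R) (w : C) (k : Z) :
  Rabs (Im w - alpha - 2 * PI * IZR k) < PI -> sheet alpha w = k.
Proof.
  intros H; apply Rabs_def2 in H; unfold sheet; symmetry.
  pose proof PI_RGT_0 as Hpi.
  apply Int_part_spec.
  set (q := (Im w - alpha) / (2 * PI)).
  assert (Hq : Im w - alpha = 2 * PI * q) by (unfold q; field; lra).
  rewrite Hq in H; nra.
Qed.

Lemma log_branch_band (alpha : R) (mu : C) :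
  Rabs (Im (log_branch alpha mu) - alpha) < PI / 2.
Proof.
  unfold log_branch; cbn [Im snd].
  set (x := atan _).
  replace (alpha + x - alpha) with x by ring.
  pose proof (atan_bound ((Im mu * cos alpha - Re mu * sin alpha)
                 / (Re mu * cos alpha + Im mu * sin alpha))) as H; fold x in H.
  apply Rabs_def1; lra.
Qed.

Lemma sheet_log_branch (alpha : R) (mu : C) : sheet alpha (log_branch alpha mu) = 0%Z.
Proof.
  apply sheet_unique; rewrite Rmult_0_r, Rminus_0_r.
  pose proof (log_branch_band alpha mu); pose proof PI_RGT_0; lra.
Qed.

(** The branch value lies within [PI / 2] of [alpha]. Moving [w] by less than [PI / 2] thus keeps it
    within [PI] of the center of its period, where rounding gives the same integer. *)
Lemma log_branch_Cexp (alpha : R) (w : C) :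
  half_plane alpha (Cexp w) ->
  w = (log_branch alpha (Cexp w) + 2 * PI * Ci * IZR (sheet alpha w))%C /\
  forall w' : C, Rabs (Im w' - Im w) < PI / 2 -> sheet alpha w' = sheet alpha w.
Proof.
  intros H.
  destruct (Cexp_inj_period w (log_branch alpha (Cexp w))) as [k Hk].
  { symmetry; apply Cexp_log_branch, H. }
  pose proof (log_branch_band alpha (Cexp w)) as Hb.
  set (l := log_branch alpha (Cexp w)) in *.
  assert (Him : Im w = Im l + 2 * PI * IZR k) by (rewrite Hk; cbn; ring).
  assert (Hk' : forall w' : C, Rabs (Im w' - Im w) < PI / 2 -> sheet alpha w' = k).
  { intros w' Hw'; apply sheet_unique.
    apply Rabs_def2 in Hw'; apply Rabs_def2 in Hb; apply Rabs_def1; lra. }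
  assert (Hs : sheet alpha w = k).
  { apply Hk'; rewrite Rminus_diag, Rabs_R0; pose proof PI_RGT_0; lra. }
  rewrite Hs; split; [exact Hk|exact Hk'].
Qed.

(** * Smoothness of locally exponential functions *)

Lemma is_derive_fst {U V : NormedModule R_AbsRing} (f : R -> U * V) (x : R) (l : U * V) :
  is_derive (V := prod_NormedModule R_AbsRing U V) f x l ->
  is_derive (fun s => fst (f s)) x (fst l).
Proof.
  intros H; unfold is_derive.
  eapply filterdiff_ext_lin;
    [eapply (filterdiff_comp' (V := prod_NormedModule R_AbsRing U V) f fst);
     [exact H|apply filterdiff_linear, is_linear_fst]|reflexivity].
Qed.

Lemma is_derive_snd {U V : NormedModule R_AbsRing} (f : R -> U * V) (x : R) (l : U * V) :
  is_derive (V := prod_NormedModule R_AbsRing U V) f x l ->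
  is_derive (fun s => snd (f s)) x (snd l).
Proof.
  intros H; unfold is_derive.
  eapply filterdiff_ext_lin;
    [eapply (filterdiff_comp' (V := prod_NormedModule R_AbsRing U V) f snd);
     [exact H|apply filterdiff_linear, is_linear_snd]|reflexivity].
Qed.

Lemma is_derive_pair {U V : NormedModule R_AbsRing} (f : R -> U) (g : R -> V)
    (x : R) (l : U) (m : V) :
  is_derive f x l -> is_derive g x m ->
  is_derive (V := prod_NormedModule R_AbsRing U V) (fun s => (f s, g s)) x (l, m).
Proof.
  intros Hf Hg; unfold is_derive.
  eapply filterdiff_ext_lin;
    [eapply (filterdiff_comp'_2 (W := prod_NormedModule R_AbsRing U V) f g pair);
     [exact Hf|exact Hg|]|].
  - apply filterdiff_linear.
    apply (is_linear_prod (T := prod_NormedModule R_AbsRing U V));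
      [apply is_linear_fst|apply is_linear_snd].
  - reflexivity.
Qed.

Lemma ddir_unique {V : NormedModule R_AbsRing} (f : V -> C) (p v : V) (l : C) :
  is_derive (V := C_R_NormedModule) (fun s : R => f (plus p (scal s v))) 0 l ->
  ddir f p v = l.
Proof.
  intros H; unfold ddir; destruct l as [a b]; f_equal; apply is_derive_unique.
  - apply (is_derive_fst _ _ _ H).
  - apply (is_derive_snd _ _ _ H).
Qed.

Lemma locally_on_line {V : NormedModule R_AbsRing} (p v : V) (P : V -> Prop) :
  locally p P -> locally 0 (fun s : R => P (plus p (scal s v))).
Proof.
  intros H.
  assert (Hc : continuous (fun s : R => plus p (scal s v)) 0).
  { apply (continuous_plus (V := V)); [apply continuous_const|].
    apply (continuous_scal_l (V := V)), continuous_id. }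
  apply Hc; replace (plus p (scal 0 v)) with p; [exact H|].
  rewrite <- (plus_zero_r p) at 1; f_equal; symmetry; apply (scal_zero_l v).
Qed.

(** A plane wave with real linear phase [m]. Characters have this form, and directional
    differentiation preserves it. *)
Definition wave {V : NormedModule R_AbsRing} (A : C) (m : V -> R) (p : V) : C :=
  (A * Cexp (0, m p))%C.

Definition locally_wave {V : NormedModule R_AbsRing} (D : V -> Prop) (f : V -> C) : Prop :=
  forall p, D p -> exists (A : C) (m : V -> R),
    is_linear m /\ locally p (fun q => f q = wave A m q).

Lemma wave_is_derive {V : NormedModule R_AbsRing} (A : C) (m : V -> R) (f : V -> C) (p v : V) :
  is_linear m -> locally p (fun q => f q = wave A m q) ->
  is_derive (V := C_R_NormedModule) (fun s : R => f (plus p (scal s v))) 0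
    (wave (A * (0, m v))%C m p).
Proof.
  intros Hm Hloc.
  apply (is_derive_ext_loc (V := C_R_NormedModule)
           (fun s : R => wave A m (plus p (scal s v)))).
  { generalize (locally_on_line p v _ Hloc); apply filter_imp.
    intros s Hs; symmetry; exact Hs. }
  apply (is_derive_ext (V := C_R_NormedModule)
    (fun s : R => (fst A * cos (m p + s * m v) - snd A * sin (m p + s * m v),
                   fst A * sin (m p + s * m v) + snd A * cos (m p + s * m v)))).
  { intros s; unfold wave.
    rewrite (linear_plus m Hm), (linear_scal m Hm).
    unfold Cexp, Cmult; cbn; rewrite exp_0; unfold plus, scal; cbn;
      unfold mult; cbn; f_equal; ring. }
  unfold wave, Cexp, Cmult; cbn; rewrite exp_0.
  apply (is_derive_pair (U := R_NormedModule) (V := R_NormedModule));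
    auto_derive; trivial; rewrite !Rmult_0_l, !Rplus_0_r; ring.
Qed.

Lemma wave_continuous {V : NormedModule R_AbsRing} (A : C) (m : V -> R) (p : V) :
  is_linear m -> continuous (U := C_R_NormedModule) (wave A m) p.
Proof.
  intros Hm.
  apply (continuous_comp (V := R_NormedModule) (W := C_R_NormedModule) m
           (fun x => (A * Cexp (0, x))%C)).
  { apply linear_cont, Hm. }
  apply (ex_derive_continuous (V := C_R_NormedModule)).
  eexists; unfold Cexp, Cmult; cbn; rewrite exp_0.
  apply (is_derive_pair (U := R_NormedModule) (V := R_NormedModule));
    auto_derive; trivial; reflexivity.
Qed.

(** Induction on [k]: the derivative along [v] is locally a wave with the same phase, its amplitude
    being multiplied by [i m(v)]. *)
Lemma locally_wave_Ck {V : NormedModule R_AbsRing} (D : V -> Prop) (k : nat) (f : V -> C) :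
  locally_wave D f -> Ck (W := C_R_NormedModule) k D f.
Proof.
  revert f; induction k as [|k IH]; intros f Hf; split; trivial.
  1,2: intros p Hp; destruct (Hf p Hp) as (A & m & Hm & Hloc);
    apply (continuous_ext_loc (U := C_R_NormedModule) _ (wave A m));
    [revert Hloc; apply filter_imp; intros q Hq; symmetry; exact Hq
    |apply wave_continuous, Hm].
  intros v; exists (fun p => ddir f p v); split.
  - intros p Hp; destruct (Hf p Hp) as (A & m & Hm & Hloc).
    pose proof (wave_is_derive A m f p v Hm Hloc) as Hd.
    rewrite (ddir_unique f p v _ Hd); exact Hd.
  - apply IH; intros p Hp; destruct (Hf p Hp) as (A & m & Hm & Hloc).
    exists (A * (0, m v))%C, m; split; [exact Hm|].
    apply locally_locally in Hloc; revert Hloc; apply filter_imp.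
    intros q Hq; apply ddir_unique, wave_is_derive; assumption.
Qed.

Lemma ddir_wave {V : NormedModule R_AbsRing} (A : C) (m : V -> R) (f : V -> C) (p v : V) :
  is_linear m -> (forall q, f q = wave A m q) ->
  ddir f p v = ((0, m v) * f p)%C.
Proof.
  intros Hm Hf.
  rewrite (ddir_unique f p v (wave (A * (0, m v))%C m p)).
  - rewrite Hf; unfold wave; ring.
  - apply wave_is_derive; [exact Hm|].
    apply filter_forall, Hf.
Qed.

(** * Characters of the torus *)

Definition torus_phase (n : Z * Z) (x : R * R) : R :=
  2 * PI * (IZR (fst n) * fst x + IZR (snd n) * snd x).

Lemma torus_phase_linear (n : Z * Z) :
  is_linear (U := prod_NormedModule R_AbsRing R_NormedModule R_NormedModule)
    (V := R_NormedModule) (torus_phase n).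
Proof.
  apply (is_linear_ext
    (U := prod_NormedModule R_AbsRing R_NormedModule R_NormedModule)
    (V := R_NormedModule)
    (fun x => plus (scal (2 * PI * IZR (fst n)) (fst x))
                   (scal (2 * PI * IZR (snd n)) (snd x)))).
  { intros x; unfold torus_phase, plus, scal; cbn; unfold mult; cbn; ring. }
  apply (is_linear_comp
    (V := prod_NormedModule R_AbsRing R_NormedModule R_NormedModule)
    (W := R_NormedModule)
    (fun x : R * R => (scal (2 * PI * IZR (fst n)) (fst x),
                       scal (2 * PI * IZR (snd n)) (snd x)))
    (fun y => plus (fst y) (snd y))).
  2: apply is_linear_plus.
  apply (is_linear_prod
    (T := prod_NormedModule R_AbsRing R_NormedModule R_NormedModule)).
  - apply (is_linear_comp
      (U := prod_NormedModule R_AbsRing R_NormedModule R_NormedModule)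
      (V := R_NormedModule) (W := R_NormedModule) fst (scal (2 * PI * IZR (fst n)))).
    + apply is_linear_fst.
    + apply (is_linear_scal_r (V := R_NormedModule)), Rmult_comm.
  - apply (is_linear_comp
      (U := prod_NormedModule R_AbsRing R_NormedModule R_NormedModule)
      (V := R_NormedModule) (W := R_NormedModule) snd (scal (2 * PI * IZR (snd n)))).
    + apply is_linear_snd.
    + apply (is_linear_scal_r (V := R_NormedModule)), Rmult_comm.
Qed.

(** [rep] picks some point congruent to [x]; an integer translation changes the phase by a multiple
    of [2 PI], which [Cexp] does not see. *)
Lemma character_pT (n : Z * Z) (x : R * R) :
  Cx_val (character n (pT x)) = Cexp (0, torus_phase n x).
Proof.
  unfold character, Cx_exp, Cx_val; cbn [proj1_sig].
  unfold rep.
  destruct (constructive_indefinite_description _ _) as [y Hy]; cbn in Hy |- *.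
  assert (Hrel : torus_rel x y).
  { rewrite Hy; exists (0%Z, 0%Z); cbn; destruct y; cbn; f_equal; ring. }
  destruct Hrel as [[a b] ->]; cbn.
  rewrite <- (Cexp_period (0, torus_phase n x) (fst n * a + snd n * b)).
  f_equal; unfold torus_phase, Cplus, Cmult; cbn.
  rewrite plus_IZR, !mult_IZR; f_equal; ring.
Qed.

(** * The bundle Q and the fibers of the line bundle *)

Lemma Cx_eq (z w : Cx) : Cx_val z = Cx_val w -> z = w.
Proof. intros H; apply eq_sig_hprop; [intros; apply proof_irrelevance|exact H]. Qed.

Lemma Cx_val_mul (z w : Cx) : Cx_val (Cx_mul z w) = (z * w)%C.
Proof. reflexivity. Qed.

Lemma cl_eq {A : Type} (E : A -> A -> Prop) (a b : A) :
  (forall x, E a x <-> E b x) -> cl E a = cl E b.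
Proof.
  intros H.
  assert (HE : E a = E b)
    by (apply functional_extensionality; intros x; apply propositional_extensionality, H).
  unfold cl; apply eq_sig_hprop; [intros; apply proof_irrelevance|exact HE].
Qed.

Lemma rep_cl {A : Type} (E : A -> A -> Prop) (a : A) :
  (forall x, E x x) -> E a (rep (cl E a)).
Proof.
  intros Hrefl; unfold rep.
  destruct (constructive_indefinite_description _ _) as [b Hb]; cbn in Hb |- *.
  rewrite Hb; apply Hrefl.
Qed.

Lemma shift_0 (u : C * C) : shift (0%Z, 0%Z) u = u.
Proof. destruct u; unfold shift; cbn [fst snd]; f_equal; ring. Qed.

Lemma shift_add (m n : Z * Z) (u : C * C) :
  shift m (shift n u) = shift (fst m + fst n, snd m + snd n)%Z u.
Proof.
  unfold shift; cbn [fst snd]; f_equal; rewrite plus_IZR, RtoC_plus; ring.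
Qed.

Lemma character_add (m n : Z * Z) (theta : torus) :
  Cx_val (character (fst m + fst n, snd m + snd n)%Z theta)
  = (character m theta * character n theta)%C.
Proof.
  unfold character, Cx_exp, Cx_val; cbn [proj1_sig fst snd].
  rewrite <- Cexp_add, !plus_IZR, !RtoC_plus; f_equal; ring.
Qed.

Lemma character_0 (theta : torus) : Cx_val (character (0%Z, 0%Z) theta) = 1%C.
Proof.
  unfold character, Cx_exp, Cx_val; cbn [proj1_sig fst snd].
  rewrite <- Cexp_0; f_equal; ring.
Qed.

Lemma Q_rel_refl (p : (C * C) * torus * Cx) : Q_rel p p.
Proof.
  destruct p as [[u theta] z]; exists (0%Z, 0%Z); cbn [fst snd].
  rewrite shift_0; f_equal; apply Cx_eq; rewrite !Cx_val_mul.
  rewrite character_0; ring.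
Qed.

Lemma Q_rel_cl (u : C * C) (theta : torus) (z : Cx) (n : Z * Z) :
  cl Q_rel (shift n u, theta, Cx_mul (character n theta) z) = cl Q_rel (u, theta, z).
Proof.
  apply cl_eq; intros [[w psi] y]; split; intros [m Hm]; cbn [fst snd] in Hm.
  - exists (fst m + fst n, snd m + snd n)%Z; rewrite Hm; cbn [fst snd].
    rewrite shift_add; f_equal; apply Cx_eq; rewrite !Cx_val_mul.
    rewrite character_add; ring.
  - exists (fst m - fst n, snd m - snd n)%Z; rewrite Hm; cbn [fst snd].
    rewrite shift_add; cbn [fst snd]; rewrite !Z.sub_add.
    rewrite <- surjective_pairing; f_equal; apply Cx_eq; rewrite !Cx_val_mul.
    pose proof (character_add (fst m - fst n, snd m - snd n)%Z n theta) as H.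
    cbn [fst snd] in H; rewrite !Z.sub_add, <- surjective_pairing in H.
    rewrite H; ring.
Qed.

(** The chosen representative differs from [(u, theta, z)] by a deck transformation, which commutes
    with multiplication by [w]. *)
Lemma Q_act_cl (u : C * C) (theta : torus) (z w : Cx) :
  Q_act (cl Q_rel (u, theta, z)) w = cl Q_rel (u, theta, Cx_mul z w).
Proof.
  unfold Q_act.
  destruct (rep_cl Q_rel (u, theta, z) Q_rel_refl) as [n Hn]; rewrite Hn; cbn [fst snd].
  rewrite <- (Q_rel_cl u theta (Cx_mul z w) n); do 2 f_equal; apply Cx_eq; rewrite !Cx_val_mul; ring.
Qed.

(** The sections induced from two points above the same [mu] are thus related by a gauge
    transformation, to which the condition defining [CS_fiber] applies. *)
Lemma that0_shift (n : Z * Z) (u : C * C) :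
  (fun theta => Q_act (that0 (shift n u) theta) (character n theta)) = that0 u.
Proof.
  apply functional_extensionality; intros theta; unfold that0.
  rewrite Q_act_cl, <- (Q_rel_cl u theta Cx_one n).
  do 2 f_equal; apply Cx_eq; rewrite !Cx_val_mul; ring.
Qed.

Lemma e_shift (n : Z * Z) (u : C * C) : e (shift n u) = e u.
Proof. unfold e, shift; cbn [fst snd]; rewrite !Cexp_period; reflexivity. Qed.

Lemma e_eq_shift (u w : C * C) : e u = e w -> exists n, u = shift n w.
Proof.
  destruct u as [u1 u2], w as [w1 w2]; unfold e; cbn [fst snd]; intros H.
  apply pair_equal_spec in H; destruct H as [H1 H2].
  destruct (Cexp_inj_period _ _ H1) as [n1 ->].
  destruct (Cexp_inj_period _ _ H2) as [n2 ->].
  exists (n1, n2); reflexivity.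
Qed.

Lemma smooth_character (n : Z * Z) : smooth_torus (character n).
Proof.
  intros k.
  apply (locally_wave_Ck (V := prod_NormedModule R_AbsRing R_NormedModule R_NormedModule)).
  intros p _; exists 1%C, (torus_phase n); split; [apply torus_phase_linear|].
  apply filter_forall; intros q; unfold wave; rewrite character_pT; ring.
Qed.

Lemma smooth_Cx_one : smooth_torus (fun _ => Cx_one).
Proof.
  replace (fun _ : torus => Cx_one) with (character (0%Z, 0%Z)).
  - apply smooth_character.
  - apply functional_extensionality; intros theta; apply Cx_eq, character_0.
Qed.

Lemma homotopy_class_character (n : Z * Z) : homotopy_class (character n) n.
Proof.
  exists (fun _ theta => character n theta); split; [|split; reflexivity].
  intros [s p].
  apply (continuous_comp (V := prod_UniformSpace R_UniformSpace R_UniformSpace)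
           (W := C_UniformSpace) snd (fun x => Cx_val (character n (pT x)))).
  - apply continuous_snd.
  - destruct (smooth_character n 0%nat) as [H _]; apply H, I.
Qed.

Lemma ddir_constant {V : NormedModule R_AbsRing} (f : V -> C) (p v : V) (l : C) :
  (forall s : R, f (plus p (scal s v)) = l) -> ddir f p v = 0%C.
Proof.
  intros H; apply ddir_unique.
  apply (is_derive_ext (V := C_R_NormedModule) (fun _ => l)).
  - intros s; symmetry; apply H.
  - apply (is_derive_const (V := C_R_NormedModule)).
Qed.

(** Evaluates both fiber integrals below, whose integrands are constant along the torus. *)
Lemma int_square_constant (F : R * R -> C) (c : C) :
  (forall x, F x = c) -> int_square F = c.
Proof.
  intros H; unfold int_square; destruct c as [a b].
  f_equal.
  - transitivity (RInt (fun _ : R => RInt (fun _ : R => a) 0 1) 0 1).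
    + do 2 (apply RInt_ext; intros); rewrite H; reflexivity.
    + rewrite !RInt_const; unfold scal; cbn; unfold mult; cbn; ring.
  - transitivity (RInt (fun _ : R => RInt (fun _ : R => b) 0 1) 0 1).
    + do 2 (apply RInt_ext; intros); rewrite H; reflexivity.
    + rewrite !RInt_const; unfold scal; cbn; unfold mult; cbn; ring.
Qed.

(* [C * C] by itself would be given the structure of a module over [C]. *)
Definition cover_module : NormedModule R_AbsRing :=
  prod_NormedModule R_AbsRing
    (prod_NormedModule R_AbsRing C_R_NormedModule C_R_NormedModule)
    (prod_NormedModule R_AbsRing R_NormedModule R_NormedModule).

Lemma lifted_phase_linear (n : Z * Z) :
  is_linear (U := cover_module) (V := R_NormedModule) (fun q => torus_phase n (snd q)).
Proof.
  apply (is_linear_comp (U := cover_module)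
    (V := prod_NormedModule R_AbsRing R_NormedModule R_NormedModule)
    (W := R_NormedModule) snd (torus_phase n)).
  - apply is_linear_snd.
  - apply torus_phase_linear.
Qed.

Lemma dlog_character (n : Z * Z) (p X : cover) :
  dlog (on_cover (character n)) p X = (0, torus_phase n (snd X)).
Proof.
  unfold dlog.
  rewrite (ddir_wave (V := cover_module) 1%C
        (fun q : cover => torus_phase n (snd q))).
  - field; unfold on_cover; apply (proj2_sig (character n (pT (snd p)))).
  - apply lifted_phase_linear.
  - intros q; unfold on_cover, wave; rewrite character_pT; ring.
Qed.

Lemma pull_eta_one (p X : cover) :
  pull_eta (on_cover (fun _ => Cx_one)) p X
  = (- (fst (fst p) * fst (snd X)) - snd (fst p) * snd (snd X))%C.
Proof.
  unfold pull_eta, eta_hat; cbn [fst snd].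
  rewrite (ddir_constant _ _ _ 1%C) by (intros; reflexivity).
  unfold on_cover; cbn; field; exact C1_nz.
Qed.

(** This is the wedge of [- u_1 dtheta^1 - u_2 dtheta^2] with
    [2 PI i (n_1 dtheta^1 + n_2 dtheta^2)], over a torus of area 1. *)
Lemma int_torus2_character (n : Z * Z) (u : C * C) :
  int_torus2 (wedge11 (pull_eta (on_cover (fun _ => Cx_one)))
                      (dlog (on_cover (character n)))) u
  = (2 * PI * Ci * (snd u * IZR (fst n) - fst u * IZR (snd n)))%C.
Proof.
  apply int_square_constant; intros x; unfold wedge11.
  rewrite !pull_eta_one, !dlog_character; unfold torus_phase; cbn [fst snd d_theta1 d_theta2].
  destruct u as [[u1 u1'] [u2 u2']], n as [n1 n2].
  apply injective_projections; cbn; ring.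
Qed.

(** * Coefficients under deck transformations *)

Definition swap {A : Type} (p : A * A) : A * A := (snd p, fst p).

(** The function [F] of the introduction, for an arbitrary section [s]. *)
Definition that0_coefficient (s : CS_section) (u : C * C) : C := s (e u) (that0 u).

Lemma that0_coefficient_shift (s : CS_section) (n : Z * Z) (u : C * C) :
  CS_fiber (e u) (s (e u)) ->
  that0_coefficient s u
  = (sign (sigma (mod2 n))
     * Cexp (/ 2 * (snd (shift n u) * IZR (fst n) - fst (shift n u) * IZR (snd n)))
     * that0_coefficient s (shift n u))%C.
Proof.
  intros [_ H]; unfold that0_coefficient; rewrite e_shift.
  rewrite <- (that0_shift n u) at 1.
  rewrite (H (shift n u) (fun _ => Cx_one) _ (character n) n).
  - rewrite int_torus2_character; do 3 f_equal.
    set (a := (snd (shift n u) * IZR (fst n) - fst (shift n u) * IZR (snd n))%C).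
    (* The prefactor [- i / (4 PI)] times the [2 PI i] of the integral gives [/ 2]. *)
    transitivity (- (Ci * Ci) * / 2 * a)%C.
    + field; intros [= HPI]; exact (PI_neq0 HPI).
    + replace (Ci * Ci)%C with (- (1))%C; [ring|].
      apply injective_projections; cbn; ring.
  - apply e_shift.
  - split; [exact smooth_Cx_one|reflexivity].
  - apply smooth_character.
  - apply homotopy_class_character.
Qed.

Definition swap_product (s : CS_section) (u : C * C) : C :=
  (that0_coefficient s u * that0_coefficient s (swap u))%C.

(* The factors by which the two coefficients change are inverse to each other. *)
Lemma swap_product_shift (s : CS_section) (n : Z * Z) (u : C * C) :
  CS_fiber (e u) (s (e u)) -> CS_fiber (e (swap u)) (s (e (swap u))) ->
  swap_product s (shift n u) = swap_product s u.
Proof.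
  intros H1 H2; unfold swap_product.
  change (swap (shift n u)) with (shift (swap n) (swap u)).
  rewrite (that0_coefficient_shift s n u H1).
  rewrite (that0_coefficient_shift s (swap n) (swap u) H2).
  set (F := that0_coefficient s (shift n u)).
  set (G := that0_coefficient s (shift (swap n) (swap u))).
  set (E1 := Cexp _); set (E2 := Cexp _).
  assert (HE : (E1 * E2)%C = 1%C).
  { unfold E1, E2; rewrite <- Cexp_add, <- Cexp_0; f_equal.
    unfold swap, shift; cbn [fst snd]; ring. }
  assert (Hs : (sign (sigma (mod2 n)) * sign (sigma (mod2 (swap n))))%C = 1%C).
  { unfold mod2, swap, sigma; cbn [fst snd]; rewrite andb_comm.
    destruct (_ && _); unfold sign; ring. }
  transitivity ((sign (sigma (mod2 n)) * sign (sigma (mod2 (swap n)))) * (E1 * E2) * (F * G))%C.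
  - rewrite HE, Hs; ring.
  - ring.
Qed.

(** * Local trivializations and the derivative of the coefficients *)

Definition half_planes (a : R * R) (mu : C * C) : Prop :=
  half_plane (fst a) (fst mu) /\ half_plane (snd a) (snd mu).

Definition log_branches (a : R * R) (mu : C * C) : C * C :=
  (log_branch (fst a) (fst mu), log_branch (snd a) (snd mu)).

Definition sheets (a : R * R) (u : C * C) : Z * Z :=
  (sheet (fst a) (fst u), sheet (snd a) (snd u)).

(** The section induced by [that0] along the chosen branches of both logarithms. Its pullback at [u]
    is the character that carries the branch point to the sheet of [u]. *)
Definition branch_section (a : R * R) (mu : C * C) : torus -> Q :=
  that0 (log_branches a mu).

Definition branch_lift (a : R * R) (u : C * C) : torus -> Cx := character (sheets a u).

Lemma e_log_branches (a : R * R) (mu : C * C) :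
  half_planes a mu -> e (log_branches a mu) = mu.
Proof.
  intros [H1 H2]; unfold e, log_branches; cbn [fst snd].
  rewrite !Cexp_log_branch by assumption; destruct mu; reflexivity.
Qed.

Lemma shift_log_branches (a : R * R) (u : C * C) :
  half_planes a (e u) -> shift (sheets a u) (log_branches a (e u)) = u.
Proof.
  intros [H1 H2]; cbn [e fst snd] in H1, H2.
  destruct (log_branch_Cexp _ _ H1) as [E1 _].
  destruct (log_branch_Cexp _ _ H2) as [E2 _].
  unfold shift, log_branches, sheets, e; cbn [fst snd].
  rewrite <- E1, <- E2; destruct u; reflexivity.
Qed.

Lemma sheets_locally_constant (a : R * R) (u : C * C) (x : R * R) :
  half_planes a (e u) ->
  locally (T := cover_module) (u, x) (fun q => sheets a (fst q) = sheets a u).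
Proof.
  intros [H1 H2]; cbn [e fst snd] in H1, H2.
  destruct (log_branch_Cexp _ _ H1) as [_ E1].
  destruct (log_branch_Cexp _ _ H2) as [_ E2].
  assert (Hpos : 0 < PI / 2) by (pose proof PI_RGT_0; lra).
  (* Balls of the product are products of balls, so radius [PI / 2] bounds the change of both
     imaginary parts. *)
  exists (mkposreal _ Hpos); intros [w y] [[[_ B1] [_ B2]] _].
  unfold sheets; cbn [fst snd]; f_equal; [apply E1|apply E2]; [exact B1|exact B2].
Qed.

Lemma half_plane_open (alpha : R) : open (T := C_UniformSpace) (half_plane alpha).
Proof.
  apply (open_comp (T := C_UniformSpace) (U := R_UniformSpace)
    (fun mu : C => Re mu * cos alpha + Im mu * sin alpha) (fun x => 0 < x)).
  2: apply open_gt.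
  intros mu _.
  apply (continuous_plus (U := C_UniformSpace) (V := R_NormedModule));
    apply (continuous_mult (U := C_UniformSpace) (K := R_AbsRing)).
  - apply (continuous_fst (U := R_UniformSpace) (V := R_UniformSpace)).
  - apply continuous_const.
  - apply (continuous_snd (U := R_UniformSpace) (V := R_UniformSpace)).
  - apply continuous_const.
Qed.

(** Smoothness holds because the sheet numbers are locally constant, so that the lift is locally a
    single character. *)
Lemma branch_trivializing (a : R * R) :
  trivializing (half_planes a) (branch_section a) (branch_lift a).
Proof.
  split; [|split; [|split]].
  - apply (open_and (T := prod_UniformSpace C_UniformSpace C_UniformSpace)).
    + apply (open_comp (T := prod_UniformSpace C_UniformSpace C_UniformSpace)
        (U := C_UniformSpace) fst); [|apply half_plane_open].
      intros mu _; apply (continuous_fst (U := C_UniformSpace) (V := C_UniformSpace)).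
    + apply (open_comp (T := prod_UniformSpace C_UniformSpace C_UniformSpace)
        (U := C_UniformSpace) snd); [|apply half_plane_open].
      intros mu _; apply (continuous_snd (U := C_UniformSpace) (V := C_UniformSpace)).
  - intros mu [H1 H2]; split; eapply half_plane_neq_0; eassumption.
  - intros k; apply (locally_wave_Ck (V := cover_module)).
    intros [u x] Hu; cbn [fst] in Hu.
    exists 1%C, (fun q => torus_phase (sheets a u) (snd q)).
    split; [apply lifted_phase_linear|].
    generalize (sheets_locally_constant a u x Hu); apply filter_imp.
    intros q Hq; unfold branch_lift, wave; rewrite character_pT.
    rewrite Cmult_1_l.
    exact (f_equal (fun n => Cexp (0, torus_phase n (snd q))) Hq).
  - intros u theta Hu; unfold branch_section, branch_lift, that0.
    rewrite <- (Q_rel_cl (log_branches a (e u)) theta Cx_one (sheets a u)).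
    rewrite shift_log_branches by assumption.
    do 2 f_equal; apply Cx_eq; rewrite Cx_val_mul; change (Cx_val Cx_one) with (RtoC 1); ring.
Qed.

(** In coordinates, [Omega = - du_1 dtheta^1 - du_2 dtheta^2] with wedge products understood. *)
Lemma Omega_eq (p X Y : cover) :
  Omega p X Y
  = (fst (fst Y) * fst (snd X) + snd (fst Y) * snd (snd X)
     - fst (fst X) * fst (snd Y) - snd (fst X) * snd (snd Y))%C.
Proof.
  assert (H : forall W V : cover,
    ddir (V := cover_module) (fun q : cover => pull_eta (fun _ => RtoC 1) q W) p V
    = (- (fst (fst V) * fst (snd W)) - snd (fst V) * snd (snd W))%C).
  { intros W V; apply ddir_unique.
    apply (is_derive_ext (V := C_R_NormedModule)
      (fun s : R => (- ((fst (fst p) + s * fst (fst V)) * fst (snd W))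
                     - (snd (fst p) + s * snd (fst V)) * snd (snd W))%C)).
    - intros s; unfold pull_eta, eta_hat; cbn [fst snd].
      rewrite (ddir_constant _ _ _ 1%C) by (intros; reflexivity).
      destruct p as [[[p1 p1'] [p2 p2']] x], V as [[[v1 v1'] [v2 v2']] y].
      apply injective_projections; cbn; unfold mult; cbn; field.
    - destruct p as [[[p1 p1'] [p2 p2']] x], V as [[[v1 v1'] [v2 v2']] y],
        W as [w [y1 y2]].
      unfold Cminus, Cplus, Copp, Cmult, RtoC; cbn [fst snd].
      apply (is_derive_pair (U := R_NormedModule) (V := R_NormedModule));
        auto_derive; trivial; ring. }
  unfold Omega, ext_d.
  refine (eq_trans (f_equal2 Cminus (H Y X) (H X Y)) _); ring.
Qed.

Lemma CS_connection_branch (a : R * R) (u v : C * C) :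
  sheets a u = (0%Z, 0%Z) ->
  CS_connection (branch_lift a) u v
  = (Ci / (4 * PI) * (snd u * fst v - fst u * snd v))%C.
Proof.
  intros Hu; unfold CS_connection; f_equal.
  apply int_square_constant; intros x; unfold wedge12.
  (* Vertical vectors keep [u] fixed, so the lift stays equal to 1 along them. They suffice, since
     the value on the horizontal vector is multiplied by [Omega] of two torus directions, which is
     zero. *)
  assert (H : forall X : cover, fst X = (RtoC 0, RtoC 0) ->
    pull_eta (family_on_cover (branch_lift a)) (u, x) X
    = (- (fst u * fst (snd X)) - snd u * snd (snd X))%C).
  { intros [w y] HX; cbn [fst snd] in HX; subst w.
    unfold pull_eta, eta_hat; cbn [fst snd].
    rewrite (ddir_constant (V := cover_module) _ _ _ 1%C).
    - unfold Cdiv; rewrite Cmult_0_l; ring.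
    - intros s; unfold family_on_cover, branch_lift.
      replace (fst _) with u.
      + rewrite Hu; apply character_0.
      + destruct u as [[u1 u1'] [u2 u2']].
        transitivity ((u1 + s * 0, u1' + s * 0), (u2 + s * 0, u2' + s * 0));
          [rewrite !Rmult_0_r, !Rplus_0_r|]; reflexivity. }
  rewrite (H d_theta1), (H d_theta2), !Omega_eq by reflexivity; cbn [fst snd horizontal d_theta1 d_theta2].
  ring.
Qed.

Definition branch_coefficient (s : CS_section) (a : R * R) (z : C) : C :=
  coefficient s (branch_section a) (z, (1 - z)%C).

Lemma branch_coefficient_that0 (s : CS_section) (a : R * R) (z : C) :
  half_planes a (z, (1 - z)%C) ->
  branch_coefficient s a z = that0_coefficient s (log_branches a (z, (1 - z)%C)).
Proof.
  intros H; unfold that0_coefficient; rewrite e_log_branches by exact H; reflexivity.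
Qed.

(** Smoothness of the section supplies the derivative, and flatness determines its value. *)
Lemma branch_coefficient_derive (s : CS_section) (a : R * R) (z w : C) :
  flat_section' s -> half_planes a (z, (1 - z)%C) ->
  let u := log_branches a (z, (1 - z)%C) in
  is_derive (V := C_R_NormedModule)
    (fun r : R => branch_coefficient s a (z + r * w)%C) 0
    (- (Ci / (4 * PI) * (snd u * (w / z) + fst u * (w / (1 - z))))
     * branch_coefficient s a z)%C.
Proof.
  intros [[_ Hsmooth] Hflat] Hz u.
  pose proof (branch_trivializing a) as Htriv.
  destruct (Hsmooth _ _ _ Htriv 1%nat) as [_ Hd].
  destruct (Hd w) as (g & Hg & _).
  specialize (Hg z Hz).
  pose proof (e_log_branches a _ Hz) as Heu; fold u in Heu.
  assert (Hz0 : z <> 0%C) by (destruct Hz as [H _]; eapply half_plane_neq_0, H).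
  assert (Hz1 : (1 - z)%C <> 0%C) by (destruct Hz as [_ H]; eapply half_plane_neq_0, H).
  (* The vector at [u] that [de] sends to [(w, - w)], the tangent vector of [MT'] along which [z]
     moves in direction [w]. *)
  set (v := ((w / z)%C, (- (w / (1 - z)))%C)).
  assert (Hde : de u v = (w, (- w)%C)).
  { pose proof (f_equal fst Heu) as E1; pose proof (f_equal snd Heu) as E2.
    cbn [e fst snd] in E1, E2.
    unfold de, v; cbn [fst snd]; rewrite E1, E2; f_equal; field; assumption. }
  assert (Hnabla : nabla s (branch_section a) (branch_lift a) u v = RtoC 0).
  { apply (Hflat _ _ _ Htriv).
    - rewrite Heu; exact Hz.
    - rewrite Heu; split; [split; assumption|cbn [fst snd]; ring].
    - rewrite Hde; cbn [fst snd]; ring. }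
  unfold nabla in Hnabla.
  rewrite CS_connection_branch in Hnabla
    by (unfold sheets, u, log_branches; cbn [fst snd]; rewrite !sheet_log_branch; reflexivity).
  rewrite Heu, Hde in Hnabla; fold (branch_coefficient s a z) in Hnabla.
  rewrite (ddir_unique _ _ _ (g z)) in Hnabla.
  - set (l := (- _ * _)%C).
    assert (Hl : @eq C l (g z)).
    { transitivity (g z - RtoC 0)%C; [rewrite <- Hnabla|]; unfold l, v; cbn [fst snd]; ring. }
    rewrite Hl; apply (is_derive_ext (V := C_R_NormedModule) _ _ _ _) with (2 := Hg).
    intros r; unfold branch_coefficient.
    replace (z + r * w)%C with (plus (z : C_R_NormedModule) (scal r (w : C_R_NormedModule)));
      [reflexivity|].
    destruct z, w; apply injective_projections; cbn; unfold mult; cbn; ring.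
  - apply (is_derive_ext (V := C_R_NormedModule) _ _ _ _) with (2 := Hg).
    intros r; f_equal; apply injective_projections; [reflexivity|].
    destruct z, w; apply injective_projections; cbn; unfold mult; cbn; ring.
Qed.

Lemma is_derive_Cmult (f g : R -> C) (x : R) (l m : C) :
  is_derive (V := C_R_NormedModule) f x l ->
  is_derive (V := C_R_NormedModule) g x m ->
  is_derive (V := C_R_NormedModule) (fun r => (f r * g r)%C) x (l * g x + f x * m)%C.
Proof.
  intros Hf Hg.
  pose proof (is_derive_fst f x l Hf) as Hf1; pose proof (is_derive_snd f x l Hf) as Hf2.
  pose proof (is_derive_fst g x m Hg) as Hg1; pose proof (is_derive_snd g x m Hg) as Hg2.
  replace (l * g x + f x * m)%C with
    (minus (plus (mult (fst l) (fst (g x))) (mult (fst (f x)) (fst m)))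
           (plus (mult (snd l) (snd (g x))) (mult (snd (f x)) (snd m))),
     plus (plus (mult (fst l) (snd (g x))) (mult (fst (f x)) (snd m)))
          (plus (mult (snd l) (fst (g x))) (mult (snd (f x)) (fst m))))
    by (apply injective_projections; cbn; unfold minus, plus, mult, opp; cbn; ring).
  apply (is_derive_pair (U := R_NormedModule) (V := R_NormedModule)).
  - apply (is_derive_minus (V := R_NormedModule)); apply (is_derive_mult (K := R_AbsRing));
      auto using Rmult_comm.
  - apply (is_derive_plus (V := R_NormedModule)); apply (is_derive_mult (K := R_AbsRing));
      auto using Rmult_comm.
Qed.

(** [swap_product] in the coordinate [z]. Swapping the directions makes the branches at [1 - z] the
    swap of those at [z]. *)
Definition branch_product (s : CS_section) (a : R * R) (z : C) : C :=
  (branch_coefficient s a z * branch_coefficient s (swap a) (1 - z))%C.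

Lemma half_planes_swap (a : R * R) (z : C) :
  half_planes a (z, (1 - z)%C) -> half_planes (swap a) ((1 - z)%C, (1 - (1 - z))%C).
Proof.
  intros [H1 H2]; split; [exact H2|].
  replace (1 - (1 - z))%C with z by ring; exact H1.
Qed.

Lemma log_branches_swap (a : R * R) (z : C) :
  log_branches (swap a) ((1 - z)%C, (1 - (1 - z))%C) = swap (log_branches a (z, (1 - z)%C)).
Proof.
  replace (1 - (1 - z))%C with z by ring; reflexivity.
Qed.

(* The connection form [u_2 du_1 - u_1 du_2] changes sign under the swap. *)
Lemma branch_product_derive (s : CS_section) (a : R * R) (z w : C) :
  flat_section' s -> half_planes a (z, (1 - z)%C) ->
  is_derive (V := C_R_NormedModule)
    (fun r : R => branch_product s a (z + r * w)%C) 0 (RtoC 0).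
Proof.
  intros Hs Hz.
  pose proof (branch_coefficient_derive s a z w Hs Hz) as D1.
  pose proof (branch_coefficient_derive s (swap a) (1 - z)%C (- w)%C Hs
                (half_planes_swap a z Hz)) as D2.
  cbv zeta in D1, D2; rewrite log_branches_swap in D2.
  replace (1 - (1 - z))%C with z in D2 by ring.
  pose proof (is_derive_Cmult _ _ _ _ _ D1 D2) as D.
  assert (Hz0 : z <> 0%C) by (destruct Hz as [H _]; eapply half_plane_neq_0, H).
  assert (Hz1 : (1 - z)%C <> 0%C) by (destruct Hz as [_ H]; eapply half_plane_neq_0, H).
  cbn beta in D; rewrite !Cmult_0_l, !Cplus_0_r in D.
  match type of D with is_derive _ _ ?l => assert (Hl : @eq C l 0%C) end.
  { unfold swap; cbn [fst snd]; field.
    repeat split; assumption || (intros [= HPI]; exact (PI_neq0 HPI)). }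
  rewrite Hl in D.
  apply (is_derive_ext (V := C_R_NormedModule) _ _ _ _) with (2 := D).
  intros r; unfold branch_product; do 2 f_equal; ring.
Qed.

Lemma half_plane_convex (alpha : R) (z w : C) (r : R) :
  half_plane alpha z -> half_plane alpha w -> 0 <= r <= 1 ->
  half_plane alpha (z + r * (w - z))%C.
Proof.
  unfold half_plane; destruct z as [x y], w as [x' y']; cbn; intros Hz Hw [H0 H1].
  set (A := x * cos alpha + y * sin alpha) in *.
  set (B := x' * cos alpha + y' * sin alpha) in *.
  match goal with |- 0 < ?e => replace e with ((1 - r) * A + r * B) by (unfold A, B; ring) end.
  destruct (Req_dec r 0) as [->|Hr]; [lra|].
  assert (0 < r * B) by (apply Rmult_lt_0_compat; lra).
  assert (0 <= (1 - r) * A) by (apply Rmult_le_pos; lra).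
  lra.
Qed.

(** The domain is convex, so the segment from [z] to [w] stays in it, and the derivative along it
    vanishes. *)
Lemma branch_product_constant (s : CS_section) (a : R * R) (z w : C) :
  flat_section' s -> half_planes a (z, (1 - z)%C) -> half_planes a (w, (1 - w)%C) ->
  branch_product s a z = branch_product s a w.
Proof.
  intros Hs [Hz1 Hz2] [Hw1 Hw2].
  pose (f := fun r : R => branch_product s a (z + r * (w - z))%C).
  assert (E0 : branch_product s a z = f 0) by (unfold f; f_equal; ring).
  assert (E1 : branch_product s a w = f 1) by (unfold f; f_equal; ring).
  rewrite E0, E1.
  apply (eq_is_derive (V := C_R_NormedModule) f 0 1); [|lra].
  intros r Hr.
  assert (Hline : half_planes a ((z + r * (w - z))%C, (1 - (z + r * (w - z)))%C)).
  { split; cbn [fst snd]; [apply half_plane_convex; assumption|].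
    replace (1 - (z + r * (w - z)))%C with ((1 - z) + r * ((1 - w) - (1 - z)))%C by ring.
    apply half_plane_convex; assumption. }
  pose proof (branch_product_derive s a _ (w - z)%C Hs Hline) as D.
  (* The derivative is known at time 0 of the line starting at the point with parameter [r], hence
     the translation [t - r]. *)
  pose (g := fun t : R => branch_product s a (z + r * (w - z) + t * (w - z))%C).
  apply (is_derive_ext (V := C_R_NormedModule) (fun t : R => g (t - r))).
  { intros t; unfold f, g; f_equal; rewrite RtoC_minus; ring. }
  replace (zero : C_R_NormedModule) with (scal 1 (zero : C_R_NormedModule))
    by apply (scal_zero_r (V := C_R_NormedModule)).
  apply (is_derive_comp (V := C_R_NormedModule) g (fun t : R => t - r)).
  - rewrite Rminus_diag; exact D.
  - auto_derive; trivial.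
Qed.

(** * Connectedness *)

(** Points with the same image under [e] differ by a deck transformation, so the product descends to
    [MT']. *)
Lemma swap_product_fiber (s : CS_section) (u w : C * C) :
  flat_section' s -> MT' (e u) -> e u = e w -> swap_product s u = swap_product s w.
Proof.
  intros [[Hfib _] _] Hu Huw.
  destruct (e_eq_shift u w Huw) as [n ->].
  rewrite e_shift in Hu; apply swap_product_shift.
  - apply Hfib, Hu.
  - apply Hfib; destruct Hu as [[H1 H2] H3]; split; [split; assumption|].
    rewrite <- H3; apply Cplus_comm.
Qed.

Lemma swap_product_branch (s : CS_section) (a : R * R) (u : C * C) (z : C) :
  flat_section' s -> e u = (z, (1 - z)%C) -> half_planes a (z, (1 - z)%C) ->
  swap_product s u = branch_product s a z.
Proof.
  intros Hs Hu Hz.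
  rewrite (swap_product_fiber s u (log_branches a (z, (1 - z)%C)) Hs).
  - unfold swap_product, branch_product.
    rewrite <- log_branches_swap, !branch_coefficient_that0;
      [reflexivity|exact (half_planes_swap a z Hz)|exact Hz].
  - rewrite Hu; split; [|cbn [fst snd]; ring].
    destruct Hz as [H1 H2]; split; eapply half_plane_neq_0; eassumption.
  - rewrite e_log_branches by exact Hz; exact Hu.
Qed.

(** Both sides are the value of [swap_product] above [z], whatever the branches. *)
Lemma branch_product_overlap (s : CS_section) (a b : R * R) (z : C) :
  flat_section' s -> half_planes a (z, (1 - z)%C) -> half_planes b (z, (1 - z)%C) ->
  branch_product s a z = branch_product s b z.
Proof.
  intros Hs Ha Hb; pose proof (e_log_branches a _ Ha) as H.
  rewrite <- (swap_product_branch s a _ z Hs H Ha).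
  exact (swap_product_branch s b _ z Hs H Hb).
Qed.

Lemma branch_product_glue (s : CS_section) (a b : R * R) (z w : C) :
  flat_section' s -> half_planes a (z, (1 - z)%C) ->
  half_planes a (w, (1 - w)%C) -> half_planes b (w, (1 - w)%C) ->
  branch_product s a z = branch_product s b w.
Proof.
  intros Hs Ha Haw Hbw.
  rewrite (branch_product_constant s a z w Hs Ha Haw).
  exact (branch_product_overlap s a b w Hs Haw Hbw).
Qed.

(** Directions for [z] and [1 - z]. The resulting sets are [0 < Re z < 1], [Re z < 0], [Re z > 1],
    [Im z > 0] and [Im z < 0], in this order. *)
Definition strip : R * R := (0, 0).
Definition left_half : R * R := (PI, 0).
Definition right_half : R * R := (0, PI).
Definition upper_half : R * R := (PI / 2, - (PI / 2)).
Definition lower_half : R * R := (- (PI / 2), PI / 2).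

Ltac solve_half_planes :=
  unfold half_planes, half_plane; cbn [fst snd Re Im strip left_half right_half upper_half lower_half];
  rewrite ?cos_neg, ?sin_neg, ?cos_0, ?sin_0, ?cos_PI, ?sin_PI, ?cos_PI2, ?sin_PI2;
  cbn; lra.

(* Every point of [C \ {0, 1}] can be joined to [1/2 + i] through these five
   convex sets, on each of which both logarithms exist. *)
Lemma branch_product_global (s : CS_section) (z : C) :
  flat_section' s -> z <> 0%C -> (1 - z)%C <> 0%C ->
  exists a, half_planes a (z, (1 - z)%C) /\
    branch_product s a z = branch_product s upper_half (/ 2, 1).
Proof.
  intros Hs H0 H1; destruct z as [x y].
  destruct (Rtotal_order y 0) as [Hy|[->|Hy]].
  - exists lower_half; split; [solve_half_planes|].
    (* The lower half-plane is left at [1/2 - i] for the strip, which is left at [1/2 + i] for the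
       upper half-plane. *)
    rewrite (branch_product_glue s lower_half strip _ (/ 2, -1) Hs) by solve_half_planes.
    apply branch_product_glue; try solve_half_planes; exact Hs.
  - destruct (Rtotal_order x 0) as [Hx|[->|Hx]].
    + exists left_half; split; [solve_half_planes|].
      rewrite (branch_product_glue s left_half upper_half _ (-1, 1) Hs) by solve_half_planes.
      apply branch_product_constant; try solve_half_planes; exact Hs.
    + exfalso; apply H0; reflexivity.
    + destruct (Rtotal_order x 1) as [Hx1|[->|Hx1]].
      * exists strip; split; [solve_half_planes|].
        apply branch_product_glue; try solve_half_planes; exact Hs.
      * exfalso; apply H1; apply injective_projections; cbn; ring.
      * exists right_half; split; [solve_half_planes|].
        rewrite (branch_product_glue s right_half upper_half _ (2, 1) Hs) by solve_half_planes.
        apply branch_product_constant; try solve_half_planes; exact Hs.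
  - exists upper_half; split; [solve_half_planes|].
    apply branch_product_constant; try solve_half_planes; exact Hs.
Qed.

Lemma swap_product_constant (s : CS_section) (u : MThat') :
  flat_section' s ->
  swap_product s (proj1_sig u) = branch_product s upper_half (/ 2, 1).
Proof.
  intros Hs; destruct u as [[u1 u2] Hu]; cbn [proj1_sig fst snd] in Hu |- *.
  assert (Hu2 : Cexp u2 = (1 - Cexp u1)%C) by (rewrite <- Hu; ring).
  destruct (branch_product_global s (Cexp u1) Hs) as (a & Ha & Heq).
  - apply Cexp_neq_0.
  - rewrite <- Hu2; apply Cexp_neq_0.
  - rewrite <- Heq; apply swap_product_branch; [exact Hs| |exact Ha].
    unfold e; cbn [fst snd]; rewrite Hu2; reflexivity.
Qed.

(** * The sum of [L] and its pullback *)

Lemma CmodZ_eq (a b : C) : CmodZ_rel a b -> cl CmodZ_rel a = cl CmodZ_rel b.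
Proof.
  intros [k ->]; apply cl_eq; intros x; split; intros [m ->].
  - exists (m - k)%Z; rewrite minus_IZR, RtoC_minus; ring.
  - exists (k + m)%Z; rewrite plus_IZR, RtoC_plus; ring.
Qed.

(** Exponents differing by [2 PI i k] become numbers differing by [(2 PI i)^2 k = - 4 PI^2 k] once
    the denominator is cleared. *)
Lemma exp_2pii_injective (a b : C) :
  Cexp (a / (2 * PI * Ci)) = Cexp (b / (2 * PI * Ci)) -> cl CmodZ_rel a = cl CmodZ_rel b.
Proof.
  intros H.
  assert (Hn : (2 * PI * Ci)%C <> 0%C).
  { intros [= _ H']; pose proof PI_neq0; lra. }
  destruct (Cexp_inj_period _ _ H) as [k Hk].
  apply CmodZ_eq; exists k.
  set (c := (2 * PI * Ci)%C) in *.
  assert (Ha : a = (b + c * c * IZR k)%C).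
  { transitivity (a / c * c)%C; [field; exact Hn|].
    rewrite Hk; field; exact Hn. }
  rewrite Ha; unfold c; destruct b; apply injective_projections; cbn; ring.
Qed.

(** Provides a base point at which the constant of the theorem is read off; it lies above
    [(1/2, 1/2)]. *)
Lemma MThat'_inhabited : exists u : MThat', True.
Proof.
  assert (H : half_planes strip ((/ 2)%C, (1 - / 2)%C)) by solve_half_planes.
  pose proof (e_log_branches strip _ H) as He.
  assert (Hu : (Cexp (fst (log_branches strip ((/ 2)%C, (1 - / 2)%C)))
     + Cexp (snd (log_branches strip ((/ 2)%C, (1 - / 2)%C))))%C = 1%C).
  { change (fst (e (log_branches strip ((/ 2)%C, (1 - / 2)%C)))
            + snd (e (log_branches strip ((/ 2)%C, (1 - / 2)%C))) = 1)%C.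
    rewrite He; cbn [fst snd]; ring. }
  exact (ex_intro _ (exist _ _ Hu) I).
Qed.

Theorem theorem5p6 (tau' tau0 : CS_section) (phi : MThat' -> Cx)
    (L : MThat' -> CmodZ)
    (Hflat : flat_section' tau') (Hnonzero : nonzero_section' tau')
    (Htau0 : is_tau0hat tau0) (HL : is_CS_function tau' tau0 phi L) :
  exists c : CmodZ, forall u : MThat', CmodZ_add (L u) (L (Psi u)) = c.
Proof.
  destruct HL as [Hphi Hexp].
  (* The relation defining [phi] is evaluated at [that0 u], where [tau0] equals 1. *)
  assert (Hinv : forall u, (phi u * that0_coefficient tau' (proj1_sig u))%C = 1%C).
  { intros u; unfold that0_coefficient.
    rewrite <- Hphi; apply Htau0. }
  set (P := branch_product tau' upper_half (/ 2, 1)).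
  assert (Hprod : forall u, (phi u * phi (Psi u) * P)%C = 1%C).
  { intros u; unfold P; rewrite <- (swap_product_constant tau' u Hflat).
    unfold swap_product; change (swap (proj1_sig u)) with (proj1_sig (Psi u)).
    transitivity ((phi u * that0_coefficient tau' (proj1_sig u))
      * (phi (Psi u) * that0_coefficient tau' (proj1_sig (Psi u))))%C; [ring|].
    rewrite !Hinv; ring. }
  destruct MThat'_inhabited as [u0 _].
  exists (CmodZ_add (L u0) (L (Psi u0))); intros u.
  apply exp_2pii_injective.
  assert (Hsum : forall w, Cexp ((rep (L w) + rep (L (Psi w))) / (2 * PI * Ci))%C
                           = (phi w * phi (Psi w))%C).
  { intros w; rewrite !Hexp; unfold exp_2pii; rewrite <- Cexp_add.
    f_equal; unfold Cdiv; ring. }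
  rewrite !Hsum.
  (* Both products are inverse to [P]; inserting the factor 1 for [u0] and regrouping gives their
     equality without division. *)
  transitivity ((phi u * phi (Psi u)) * (phi u0 * phi (Psi u0) * P))%C.
  - rewrite Hprod; ring.
  - transitivity ((phi u * phi (Psi u) * P) * (phi u0 * phi (Psi u0)))%C; [ring|].
    rewrite Hprod; ring.
Qed.
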